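(* There exists a constant $A>0$ such that for all even integers $k\ge 0$ (and trivially for odd $k$, where $H_k=0$), $|H_k|\leq C A^k k!$ for some absolute constant $C$, where \[ H_k:=(i\pi^{2})^{-k}\sum_{\substack{(n_1,\dots,n_k)\in(\mathbb{Z}\setminus\{0\})^{k}\\ n_1+\cdots+n_k= 0}} \frac{d(|n_1|)\cdots d(|n_k|)}{n_1\cdots n_k}. \] That is, $H_k\ll A^k k!$.
   Context: $d(n)$ denotes the number of positive divisors of $n$. *)

(* Defs.v *)
From HB Require Import structures.
From mathcomp Require Import all_boot all_order all_algebra.
From mathcomp Require Import all_classical all_reals all_analysis.
From mathcomp Require Import complex.

Set Implicit Arguments.
Unset Strict Implicit.
Unset Printing Implicit Defensive.
Import Order.TTheory GRing.Theory Num.Theory.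
Local Open Scope classical_set_scope.
Local Open Scope ring_scope.

Definition num_divisors (n : nat) : nat := size (divisors n).

Definition zero_sum_tuples (k : nat) : set {ffun 'I_k -> int} :=
  [set n : {ffun 'I_k -> int} | (forall i, n i != 0) /\ \sum_i n i = 0].
Arguments zero_sum_tuples k : clear implicits.

Definition H_term (R : realType) (k : nat) (n : {ffun 'I_k -> int}) : R :=
  (\prod_i (num_divisors `|n i|%N)%:R) / (\prod_i (n i)%:~R).
Arguments H_term R k n : clear implicits.

(* Sum of an absolutely summable real family: [\esum] is meaningful only for
   nonnegative terms, hence the splitting into positive and negative parts.
   The value is a junk one when [summable D (EFin \o f)] fails. *)
Definition abs_sum (R : realType) (T : choiceType) (D : set T) (f : T -> R) : R :=
  fine (\esum_(x in D) ((EFin \o f)^\+ x)%E) -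
  fine (\esum_(x in D) ((EFin \o f)^\- x)%E).

Definition H (R : realType) (k : nat) : R[i] :=
  ('i * (pi ^+ 2)%:C)%C ^- k *
  (abs_sum (zero_sum_tuples k) (H_term R k))%:C%C.

(* Main.v *)
(** Let [e_J(x) = \sum_(1 <= m, l < 2^J) (e(m l x) - e(- m l x)) / (m l)], a trigonometric
    polynomial whose Fourier coefficients agree with [d(|n|)/n] for [|n| < 2^J] and never
    exceed it in modulus. The zero-sum sum with these coefficients is the mean of [e_J^k]
    over the [q]-th roots of unity for large [q], so that no integral is needed.
    Cut [m] (and [l]) into dyadic blocks. Summing over [l] first, each [m]-block is a bounded
    sum of truncated sawtooth series, hence bounded; counting the solutions of
    [m l = m' l'] shows that the mean square of the [i]-th block decays like [(3/4)^i].
    Interpolating, the [k]-th moment of the [i]-th block is [O(1)^k (3/4)^i], and Jensen's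
    inequality with weights proportional to [(1 - 1/(4k))^i] gives [(64 k)^k] for [e_J^k].
    Replacing the minus sign by a plus sign, and using double blocks bounded trivially
    by 1, the same argument gives absolute summability (with a worse constant). *)
Require Import Defs.
From HB Require Import structures.
From mathcomp Require Import all_boot all_order all_algebra.
From mathcomp Require Import all_classical all_reals all_analysis.
From mathcomp Require Import complex.
From mathcomp Require Import cyclic separable cyclotomic ring lra zify.
Import Order.TTheory GRing.Theory Num.Theory.
Import Normc.
Local Open Scope classical_set_scope.
Local Open Scope ring_scope.

(** * Moments of a sum of bounded pieces *)

(** Convexity of the power: its graph lies above the tangent at [t]. In the induction, multiplying
    by [y] leaves the nonnegative defect [k.+1%:R * t ^+ k * (y - t) ^+ 2]. *)
Lemma power_tangent (R : realDomainType) (y t : R) (k : nat) :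
  0 <= y -> 0 <= t ->
  t ^+ k.+1 + k.+1%:R * t ^+ k * (y - t) <= y ^+ k.+1.
Proof.
move=> y0 t0; elim: k => [|k IH]; first by rewrite !expr1 expr0; lra.
have := ler_wpM2l y0 IH; rewrite -exprS; apply: le_trans.
have h : 0 <= k.+1%:R * t ^+ k * (y - t) ^+ 2.
  by rewrite mulr_ge0 ?sqr_ge0 // mulr_ge0 ?exprn_ge0 ?ler0n.
rewrite -subr_ge0; apply: le_trans h _; rewrite le_eqVlt; apply/orP; left.
by apply/eqP; rewrite !exprS -!natr1; ring.
Qed.

(** Jensen's inequality at the points [y i / lam i] with weights [lam i], obtained by summing
    tangents at [t]. A total weight below 1 only adds the excess
    [k%:R * (1 - \sum_i lam i) * t ^+ k.+1]. *)
Lemma weighted_power_sum (R : realFieldType) (I : finType) (lam y : I -> R)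
    (k : nat) :
  (forall i, 0 < lam i) -> \sum_i lam i <= 1 -> (forall i, 0 <= y i) ->
  (\sum_i y i) ^+ k.+1 <= \sum_i y i ^+ k.+1 / lam i ^+ k.
Proof.
move=> lam0 lam1 y0; set t := \sum_i y i.
have t0 : 0 <= t by apply: sumr_ge0.
have step i : lam i * t ^+ k.+1 + k.+1%:R * t ^+ k * (y i - lam i * t)
    <= y i ^+ k.+1 / lam i ^+ k.
  have li := lt0r_neq0 (lam0 i).
  have yl : 0 <= y i / lam i by rewrite divr_ge0 ?y0 ?ltW.
  have := ler_wpM2l (ltW (lam0 i)) (power_tangent _ _ _ k yl t0).
  rewrite [X in _ <= X -> _](_ : _ = y i ^+ k.+1 / lam i ^+ k); last first.
    by rewrite expr_div_n !exprS; field; rewrite li expf_neq0.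
  by apply: le_trans; rewrite le_eqVlt; apply/orP; left; apply/eqP; field.
apply: le_trans (ler_sum _ (fun i _ => step i)).
rewrite big_split /= -mulr_suml -mulr_sumr sumrB -mulr_suml -/t.
have e : k.+1%:R * t ^+ k * (t - (\sum_i lam i) * t) =
  k.+1%:R * (1 - \sum_i lam i) * t ^+ k.+1 by rewrite exprS; ring.
rewrite e -mulrDl ler_peMl ?exprn_ge0 // -natr1.
have : 0 <= k%:R * (1 - \sum_i lam i) by rewrite mulr_ge0 ?ler0n ?subr_ge0.
lra.
Qed.

(* Interpolation between the sup bound [K] and the mean square bound of each
   piece: [|f i x|^(k+2) <= K^k (f i x)^2]. *)
Lemma moment_bound (R : realFieldType) (X I : finType) (f : I -> X -> R)
    (lam rho : I -> R) (N C K : R) (k : nat) :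
  (forall i, 0 < lam i) -> \sum_i lam i <= 1 -> 0 <= N -> 0 <= C -> 0 <= K ->
  (forall i x, `|f i x| <= K) ->
  (forall i, \sum_x f i x ^+ 2 <= N * (K ^+ 2 * rho i)) ->
  (forall i, rho i <= C * lam i ^+ k.+2) ->
  \sum_x `|\sum_i f i x| ^+ k.+2 <= N * (C * K ^+ k.+2).
Proof.
move=> lam0 lam1 N0 C0 K0 fK f2 rhoC.
have point x : `|\sum_i f i x| ^+ k.+2 <=
    \sum_i K ^+ k * f i x ^+ 2 / lam i ^+ k.+1.
  apply: le_trans (_ : (\sum_i `|f i x|) ^+ k.+2 <= _).
    by apply: lerXn2r; rewrite ?nnegrE ?sumr_ge0 // ler_norm_sum.
  apply: le_trans (weighted_power_sum _ _ lam _ k.+1 lam0 lam1 _) _ => //.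
  apply: ler_sum => i _; rewrite ler_wpM2r ?invr_ge0 ?exprn_ge0 ?(ltW (lam0 i)) //.
  rewrite -addn2 exprD real_normK ?num_real //.
  by apply: ler_pM; rewrite ?sqr_ge0 ?exprn_ge0 //; apply: lerXn2r; rewrite ?nnegrE.
apply: le_trans (ler_sum _ (fun x _ => point x)) _.
rewrite exchange_big /=.
(* [rho i] supplies [lam i ^+ k.+2] and Jensen divides by [lam i ^+ k.+1]; the one weight left over
   sums to at most 1. *)
apply: le_trans (_ : \sum_i N * (C * K ^+ k.+2) * lam i <= _); last first.
  by rewrite -mulr_sumr; apply: ler_piMr => //; apply/mulr_ge0/mulr_ge0/exprn_ge0.
apply: ler_sum => i _; rewrite -mulr_suml -mulr_sumr ler_pdivrMr ?exprn_gt0 //.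
apply: le_trans (ler_wpM2l (exprn_ge0 k K0) (f2 i)) _.
apply: le_trans (_ : K ^+ k * (N * (K ^+ 2 * (C * lam i ^+ k.+2))) <= _).
  by rewrite !ler_wpM2l ?exprn_ge0.
by rewrite le_eqVlt; apply/orP; left; apply/eqP; rewrite !exprS; ring.
Qed.

Lemma bernoulli_one_sub (R : realFieldType) (n : nat) (x : R) :
  0 <= x -> x <= 1 -> 1 - n%:R * x <= (1 - x) ^+ n.
Proof.
move=> x0 x1; elim: n => [|n IH]; first by rewrite expr0; lra.
have x1' : 0 <= 1 - x by lra.
have := ler_wpM2l x1' IH; rewrite -exprS; apply: le_trans.
have : 0 <= n%:R * x ^+ 2 by rewrite mulr_ge0 ?sqr_ge0 ?ler0n.
by rewrite -natr1; nra.
Qed.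

(* The ratio is chosen so that its [n.+1]-th power still dominates [3/4], by
   Bernoulli's inequality. *)
Definition geom_weight (R : realFieldType) (n i : nat) : R :=
  (1 - (4 * n.+1%:R)^-1) ^+ i / (4 * n.+1%:R).

Section GeomWeight.
Variables (R : realFieldType) (n : nat).
Local Notation h := ((4 * n.+1%:R)^-1 : R).

Let h_gt0 : 0 < h. Proof. by rewrite invr_gt0 mulr_gt0 ?ltr0n. Qed.

Let h_le : h <= 4^-1.
Proof. by rewrite lef_pV2 ?posrE ?mulr_gt0 ?ltr0n // ler_peMr ?ler1n. Qed.

Lemma geom_weight_gt0 i : 0 < geom_weight R n i.
Proof. by rewrite mulr_gt0 ?h_gt0 ?exprn_gt0 //; move: h_le h_gt0; set x := h; lra. Qed.

Lemma sum_geom_weight J : \sum_(i < J) geom_weight R n i <= 1.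
Proof.
have -> : \sum_(i < J) geom_weight R n i = 1 - (1 - h) ^+ J.
  elim: J => [|J IH]; first by rewrite big_ord0 expr0 subrr.
  by rewrite big_ord_recr /= IH /geom_weight exprS; ring.
by rewrite lerBlDr lerDl exprn_ge0 //; move: h_le h_gt0; set x := h; lra.
Qed.

Lemma le_geom_weight i :
  (3 / 4) ^+ i <= (4 * n.+1%:R) ^+ n.+1 * geom_weight R n i ^+ n.+1.
Proof.
have n0 : 4 * n.+1%:R != 0 :> R by rewrite mulf_neq0 ?pnatr_eq0.
rewrite /geom_weight [in leRHS]expr_div_n mulrCA divff ?expf_neq0 // mulr1.
have h1 : h <= 1 by move: h_le; set x := h; lra.
rewrite -exprM mulnC exprM; apply: lerXn2r;
  rewrite ?nnegrE ?exprn_ge0 ?subr_ge0 ?divr_ge0 ?ler0n //.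
have := bernoulli_one_sub R n.+1 h (ltW h_gt0) h1.
apply: le_trans; have -> : n.+1%:R * h = 4^-1.
  by rewrite invfM mulrCA divff ?mulr1 // pnatr_eq0.
lra.
Qed.

End GeomWeight.

(** * Roots of unity and truncated sawtooth series *)

(** A geometric sum: if [z ^ n] is not 1, its [q]-th power still is, so the sum vanishes. This
    orthogonality replaces integration over the circle. *)
Lemma sum_unity_root (F : fieldType) (q : nat) (z : F) (n : int) :
  q.-primitive_root z ->
  \sum_(j < q) (z ^+ j) ^ n = if (q %| n)%Z then q%:R else 0.
Proof.
move=> zq; have dvdE : (q %| n)%Z = (z ^ n == 1).
  case: n => m; first by rewrite -exprnP -(prim_order_dvd zq).
  rewrite NegzE -exprnN invr_eq1 -(prim_order_dvd zq).
  by [].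
have -> : \sum_(j < q) (z ^+ j) ^ n = \sum_(j < q) (z ^ n) ^+ j.
  by apply: eq_bigr => j _; rewrite !exprnP !exprz_exp mulrC.
rewrite dvdE; case: eqP => [->|/eqP wn1].
  by rewrite (eq_bigr (fun=> 1)) ?sumr_const ?card_ord // => j _; rewrite expr1n.
apply/eqP; have := subrX1 (z ^ n) q.
rewrite exprnP exprz_exp mulrC -exprz_exp -exprnP (prim_expr_order zq) exp1rz.
by rewrite subrr => /esym/eqP; rewrite mulf_eq0 subr_eq0 (negbTE wn1).
Qed.

(** ['X^n - 1] is separable when [n] is nonzero in [F], so there are [n] distinct [n]-th roots of
    unity, one of them primitive. *)
Lemma exists_prim_root (F : closedFieldType) (n : nat) :
  n%:R != 0 :> F -> {z : F | n.-primitive_root z}.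
Proof.
move=> nF; have n_gt0 : (0 < n)%N by case: n nF => //; rewrite eqxx.
pose p : {poly F} := 'X^n - 1; have [r Dp] := closed_field_poly_normal p.
apply/sigW; rewrite (monicP _) ?monicXnsubC // scale1r in Dp.
have rn1 : all n.-unity_root r by apply/allP=> z; rewrite -root_prod_XsubC -Dp.
have sz_r : (n < (size r).+1)%N.
  by rewrite -(size_prod_XsubC r id) -Dp size_XnsubC.
have [|z] := hasP (has_prim_root n_gt0 rn1 _ sz_r); last by exists z.
by rewrite -separable_prod_XsubC -Dp separable_Xn_sub_1.
Qed.

Section ComplexModulus.
Variable R : realType.
Implicit Types (z w : R[i]).

Lemma normc_ge0 z : 0 <= normc z.
Proof. by case: z => a b; rewrite sqrtr_ge0. Qed.

Lemma normc_real (x : R) : normc x%:C%C = `|x|.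
Proof. by rewrite /normc /= expr0n /= addr0 sqrtr_sqr. Qed.

Lemma normc_nat (n : nat) : normc (n%:R : R[i]) = n%:R.
Proof. by rewrite -(rmorph_nat (real_complex R)) normc_real ger0_norm. Qed.

Lemma normcX z (n : nat) : normc (z ^+ n) = normc z ^+ n.
Proof.
by elim: n => [|n IH]; rewrite ?expr0 ?normc1 // !exprS normcM IH.
Qed.

Lemma normcB z w : normc (z - w) <= normc z + normc w.
Proof. by rewrite -(normcN w) le_normcD. Qed.

Lemma le_normc_sum (I : Type) (s : seq I) (P : pred I) (F : I -> R[i]) :
  normc (\sum_(i <- s | P i) F i) <= \sum_(i <- s | P i) normc (F i).
Proof.
elim/big_rec2: _ => [|i x y _ IH]; first by rewrite normc0.
by rewrite (le_trans (le_normcD _ _)) // lerD2l.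
Qed.

Lemma sqr_normcE z : normc z ^+ 2 = complex.Re z ^+ 2 + complex.Im z ^+ 2.
Proof. by case: z => a b; rewrite sqr_sqrtr ?addr_ge0 ?sqr_ge0. Qed.

Lemma normc_geRe z : `|complex.Re z| <= normc z.
Proof.
by rewrite -sqrtr_sqr; case: z => a b; rewrite ler_wsqrtr // lerDl sqr_ge0.
Qed.

Lemma normc_geIm z : `|complex.Im z| <= normc z.
Proof.
by rewrite -sqrtr_sqr; case: z => a b; rewrite ler_wsqrtr // lerDr sqr_ge0.
Qed.

Lemma ImD z w : complex.Im (z + w) = complex.Im z + complex.Im w.
Proof. by case: z w => ? ? []. Qed.

Lemma Im_sum (I : Type) (s : seq I) (P : pred I) (F : I -> R[i]) :
  complex.Im (\sum_(i <- s | P i) F i) = \sum_(i <- s | P i) complex.Im (F i).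
Proof. by apply: (big_morph _ ImD). Qed.

Lemma Re_sum (I : Type) (s : seq I) (P : pred I) (F : I -> R[i]) :
  complex.Re (\sum_(i <- s | P i) F i) = \sum_(i <- s | P i) complex.Re (F i).
Proof. by apply: big_morph => // -[? ?] []. Qed.

Lemma sqr_normc_conj z : (normc z ^+ 2)%:C%C = z * (z^*)%C.
Proof. by rewrite rmorphXn /= -sqr_normc. Qed.

Lemma normc_unity (q : nat) z : (0 < q)%N -> z ^+ q = 1 -> normc z = 1.
Proof.
move=> q0 zq; apply/eqP; rewrite -(@pexpr_eq1 _ _ q) ?normc_ge0 //.
by rewrite -normcX zq normc1.
Qed.

Lemma conjc_unit z : normc z = 1 -> (z^*)%C = z^-1.
Proof.
move=> z1; have := sqr_normc_conj z; rewrite z1 expr1n => e.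
have z0 : z != 0 by apply/eqP => ze; move/eqP: z1; rewrite ze normc0 eq_sym oner_eq0.
by apply: (mulfI z0); rewrite -e divff.
Qed.

Lemma normc_sub1X w (l : nat) :
  normc w = 1 -> normc (w ^+ l - 1) <= l%:R * normc (w - 1).
Proof.
move=> w1; rewrite subrX1 normcM mulrC ler_wpM2r ?normc_ge0 //.
apply: le_trans (le_normc_sum _ _ _ _) _.
rewrite (eq_bigr (fun=> 1)) ?sumr_const ?card_ord // => j _.
by rewrite normcX w1 expr1n.
Qed.

(* Abel summation, with the boundary term kept so that the induction on [b]
   goes through. *)
Lemma abel_harmonic_tail w (a b : nat) : normc w = 1 -> (0 < a <= b)%N ->
  normc ((1 - w) * \sum_(a <= l < b) w ^+ l / l%:R + w ^+ b / b%:R)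
    <= 2 / a%:R - b%:R^-1.
Proof.
move=> w1 /andP[a0 ab]; rewrite -(subnK ab).
elim: (b - a)%N => [|d IH].
  rewrite add0n big_geq // mulr0 add0r normcM normcX w1 expr1n mul1r.
  by rewrite normcV normc_nat; lra.
rewrite addSn big_nat_recr ?leq_addl //=; set b' := (d + a)%N in IH *.
have b0 : (0 < b')%N by rewrite ltn_addl.
(* The new summand and the change of boundary term merge into a single term, whose modulus is a
   telescoping difference. *)
rewrite [X in normc X](_ : _ = (1 - w) * \sum_(a <= l < b') w ^+ l / l%:R
   + w ^+ b' / b'%:R + w ^+ b'.+1 * (b'.+1%:R^-1 - b'%:R^-1)); last first.
  by rewrite exprS; ring.
apply: le_trans (le_normcD _ _) _.
have -> : normc (w ^+ b'.+1 * (b'.+1%:R^-1 - b'%:R^-1)) = b'%:R^-1 - b'.+1%:R^-1.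
  rewrite normcM normcX w1 expr1n mul1r -opprB normcN.
  rewrite -!(rmorph_nat (real_complex R)) -!fmorphV -rmorphB normc_real ger0_norm //.
  by rewrite subr_ge0 lef_pV2 ?posrE ?ltr0n // ler_nat.
by apply: le_trans (lerD IH (lexx _)) _; rewrite addrA subrK.
Qed.

(** The sum is cut near 1/|1 - w|. Before the cut each term is at most |1 - w|, for a total of at
    most 1; after it Abel summation gives at most 2. *)
Lemma sine_sum_le w (L : nat) : normc w = 1 ->
  `|complex.Im (\sum_(1 <= l < L) w ^+ l / l%:R)| <= 3.
Proof.
move=> w1; set D := normc (1 - w).
have D1 : normc (w - 1) = D by rewrite -normcN opprB.
have [D0|Dn0] := eqVneq D 0.
  have /eqP := eq0_normc D0; rewrite subr_eq0 eq_sym => /eqP ->.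
  rewrite Im_sum big1 ?normr0 // => l _.
  by rewrite expr1n mul1r -(rmorph_nat (real_complex R)) -fmorphV.
have Dp : 0 < D by rewrite lt0r Dn0 normc_ge0.
set t := Num.trunc D^-1.
have /andP[tD Dt] : (t%:R <= D^-1 < t.+1%:R) by apply: truncn_itv; rewrite invr_ge0 ltW.
have small M : (M <= t.+1)%N -> `|complex.Im (\sum_(1 <= l < M) w ^+ l / l%:R)| <= 1.
  move=> Mt; rewrite Im_sum; apply: le_trans (ler_norm_sum _ _ _) _.
  apply: le_trans (_ : \sum_(1 <= l < M) D <= _).
    rewrite !big_nat; apply: ler_sum => l /andP[l0 _].
    (* Subtracting the real number 1/l leaves the imaginary part unchanged and makes the term small
       for [w] near 1. *)
    have -> : complex.Im (w ^+ l / l%:R) = complex.Im ((w ^+ l - 1) / l%:R).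
      rewrite mulrBl ImD -[X in _ = _ + X]/(complex.Im (- (1 / l%:R))).
      by rewrite mul1r -(rmorph_nat (real_complex R)) -fmorphV /= oppr0 addr0.
    apply: le_trans (normc_geIm _) _.
    rewrite normcM normcV normc_nat ler_pdivrMr ?ltr0n // mulrC -D1.
    exact: normc_sub1X.
  rewrite sumr_const_nat -mulr_natl.
  apply: le_trans (_ : t%:R * D <= _).
    by rewrite ler_wpM2r ?(ltW Dp) // ler_nat leq_subLR.
  by rewrite -ler_pdivlMr // mul1r.
have [Lt|tL] := leqP L t.+1; first by apply: le_trans (small _ Lt) _; lra.
rewrite (@big_cat_nat _ _ _ t.+1) //= ?(ltnW tL) //.
rewrite ImD; apply: le_trans (ler_normD _ _) _.
suff : `|complex.Im (\sum_(t.+1 <= l < L) w ^+ l / l%:R)| <= 2.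
  by have := small _ (leqnn t.+1); set u := `|_|; set v := `|_|; lra.
apply: le_trans (normc_geIm _) _; set S := \sum_(_ <= l < _) _.
have L0 : (0 < L)%N by apply: leq_trans tL.
have ab := abel_harmonic_tail w t.+1 L w1 (ltnW tL).
have DS : D * normc S <= 2 / t.+1%:R.
  rewrite -normcM -[_ * S](addrK (w ^+ L / L%:R)).
  apply: le_trans (normcB _ _) _.
  rewrite [X in _ + X](_ : _ = L%:R^-1); first by rewrite -lerBrDr.
  by rewrite normcM normcX w1 expr1n mul1r normcV normc_nat.
rewrite -(ler_pM2l Dp); apply: le_trans DS _.
rewrite ler_pdivrMr ?ltr0n // mulrAC -ler_pdivrMr ?ltr0n // divff //.
by rewrite -ler_pdivrMl // mulr1 ltW.
Qed.

End ComplexModulus.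

(** * Dyadic blocks *)

(** Squared coefficient bound times solution count for a block with side lengths [m] and [n], where
    [m] is the smaller. *)
Lemma sqr_inv_prod_mul (R : numFieldType) (m n : nat) :
  (0 < m)%N -> (0 < n)%N ->
  (m * n)%:R^-1 ^+ 2 * (m * n * m)%:R = n%:R^-1 :> R.
Proof.
move=> m0 n0; have m1 : m%:R != 0 :> R by rewrite pnatr_eq0 -lt0n.
have n1 : n%:R != 0 :> R by rewrite pnatr_eq0 -lt0n.
by rewrite !natrM; field; rewrite m1 n1.
Qed.

(** Since 1/2 <= (3/4)^2, decay in the larger index alone can be shared between both indices. *)
Lemma half_power_le (R : realFieldType) (n m : nat) :
  (m <= n)%N -> (2 ^ n)%:R^-1 <= (3 / 4) ^+ n * (3 / 4) ^+ m :> R.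
Proof.
move=> mn; have r0 : 0 <= 3 / 4 :> R by lra.
have r1 : 3 / 4 <= 1 :> R by lra.
apply: le_trans (_ : (3 / 4) ^+ n * (3 / 4) ^+ n <= _).
  rewrite -exprMn natrX -exprVn; apply: lerXn2r; rewrite ?nnegrE.
  - by rewrite invr_ge0 ler0n.
  - by rewrite mulr_ge0.
  - lra.
by rewrite ler_wpM2l ?exprn_ge0 // ler_wiXn2l.
Qed.

Lemma ler_nat_inv (R : numFieldType) (m n : nat) :
  (0 < m)%N -> (m <= n)%N -> n%:R^-1 <= m%:R^-1 :> R.
Proof.
by move=> m0 mn; rewrite lef_pV2 ?posrE ?ltr0n ?ler_nat // (leq_trans m0).
Qed.

Lemma dyadic_sum (V : nmodType) (phi : nat -> V) (J : nat) :
  \sum_(i < J) \sum_(a < 2 ^ i) phi (2 ^ i + a)%N = \sum_(1 <= m < 2 ^ J) phi m.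
Proof.
elim: J => [|J IH]; first by rewrite big_ord0 big_geq.
rewrite big_ord_recr /= IH [RHS](@big_cat_nat _ _ _ (2 ^ J)) ?expn_gt0 //=.
  congr (_ + _); rewrite expnS mul2n -addnn -[X in \sum_(X <= _ < _) _]add0n.
  by rewrite big_addn addnK big_mkord; apply: eq_bigr => a _; rewrite addnC.
by rewrite leq_exp2l.
Qed.

(** Three of the four factors determine the last; dropping one from either range gives the two
    bounds behind the minimum. *)
Lemma card_equal_products (A B : nat) : (0 < A)%N -> (0 < B)%N ->
  (#|[pred x : ('I_A * 'I_B) * ('I_A * 'I_B) |
      ((A + x.1.1) * (B + x.1.2) == (A + x.2.1) * (B + x.2.2))%N]|
    <= A * B * minn A B)%N.
Proof.
move=> A0 B0; set D := [pred x | _].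
have pos (n m : nat) : (0 < n)%N -> (0 < n + m)%N by case: n.
rewrite minnMr leq_min; apply/andP; split.
- pose f (x : ('I_A * 'I_B) * ('I_A * 'I_B)) := (x.1, x.2.1).
  have fI : {in D &, injective f}.
    move=> [[a b] [a' b']] [[c d] [c' d']]; rewrite !inE /= => /eqP e1 /eqP e2.
    case=> ac bd ac'; subst; do 2 congr (_, _); apply: val_inj => /=.
    by move: e1; rewrite e2 => /eqP; rewrite eqn_pmul2l ?pos // eqn_add2l => /eqP.
  by rewrite -(card_in_imset fI) (leq_trans (max_card _)) // !card_prod !card_ord.
- pose f (x : ('I_A * 'I_B) * ('I_A * 'I_B)) := (x.1, x.2.2).
  have fI : {in D &, injective f}.
    move=> [[a b] [a' b']] [[c d] [c' d']]; rewrite !inE /= => /eqP e1 /eqP e2.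
    case=> ac bd ac'; subst; do 2 congr (_, _); apply: val_inj => /=.
    by move: e1; rewrite e2 => /eqP; rewrite eqn_pmul2r ?pos // eqn_add2l => /eqP.
  by rewrite -(card_in_imset fI) (leq_trans (max_card _)) // !card_prod !card_ord.
Qed.

Lemma dvdz_small (q : nat) (n : int) : (`|n| < q)%N -> (q %| n)%Z = (n == 0).
Proof.
move=> nq; apply/idP/eqP => [|->]; last exact: dvdz0.
rewrite /dvdz /= => /dvdn_leq h; apply/eqP; rewrite -absz_eq0 -leqn0 leqNgt.
by apply/negP => /h; rewrite leqNgt nq.
Qed.

Section MeanSquare.
Variables (R : realType) (q : nat) (zeta : R[i]).
Hypothesis zetaq : q.-primitive_root zeta.

Let q_gt0 : (0 < q)%N := prim_order_gt0 zetaq.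

Lemma prim_root_neq0 : zeta != 0.
Proof.
apply/eqP => ze; have := prim_expr_order zetaq; rewrite ze => /eqP.
by rewrite expr0n gtn_eqF // eq_sym oner_eq0.
Qed.

Lemma normc_prim_rootX (j : nat) : normc (zeta ^+ j) = 1.
Proof. by rewrite normcX (normc_unity _ _ _ q_gt0 (prim_expr_order zetaq)) expr1n. Qed.

(** Parseval on the [q]-th roots of unity: all frequencies are below [q], so only pairs with equal
    frequency survive, each contributing at most [q%:R * W ^+ 2]. *)
Lemma mean_square_le (P : finType) (nu : P -> nat) (c : P -> R) (W : R) :
  (forall p, (nu p < q)%N) -> (forall p, 0 <= c p <= W) ->
  \sum_(j < q) normc (\sum_p (c p)%:C%C * (zeta ^+ j) ^+ nu p) ^+ 2
    <= q%:R * (W ^+ 2 * #|[pred x : P * P | nu x.1 == nu x.2]|%:R).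
Proof.
move=> nuq cW.
have -> : \sum_(j < q) normc (\sum_p (c p)%:C%C * (zeta ^+ j) ^+ nu p) ^+ 2
  = \sum_p \sum_p' c p * c p' * (if nu p == nu p' then q%:R else 0).
  apply: complexI; rewrite rmorph_sum /=.
  rewrite (eq_bigr (fun j : 'I_q => \sum_p \sum_p'
     (c p * c p')%:C%C * (zeta ^+ j) ^ ((nu p)%:Z - (nu p')%:Z))); last first.
    move=> j _; rewrite sqr_normc_conj rmorph_sum /= mulr_suml.
    apply: eq_bigr => p _; rewrite mulr_sumr; apply: eq_bigr => p' _.
    rewrite !rmorphM /= oppr0 complexr0 rmorphXn /= conjc_unit ?normc_prim_rootX //.
    rewrite expfzDr ?expf_neq0 ?prim_root_neq0 // -exprnN exprVn.
    by rewrite -exprnP; ring.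
  rewrite exchange_big rmorph_sum /=; apply: eq_bigr => p _.
  rewrite exchange_big rmorph_sum /=; apply: eq_bigr => p' _.
  rewrite -mulr_sumr (sum_unity_root _ _ _ _ zetaq).
  rewrite dvdz_small; last first.
    by have := nuq p; have := nuq p'; lia.
  by rewrite subr_eq0 eqz_nat; case: eqP => _; rewrite [RHS]rmorphM ?rmorph_nat ?rmorph0.
rewrite pair_big /= -sum1_card natr_sum mulr_sumr mulr_sumr [leRHS]big_mkcond /=.
apply: ler_sum => -[p p'] _ /=; rewrite inE /=.
case: eqP => _; last by rewrite mulr0.
rewrite mulr1 mulrC ler_wpM2l ?ler0n // expr2.
by have /andP[? ?] := cW p; have /andP[? ?] := cW p'; apply: ler_pM.
Qed.

End MeanSquare.

Section Blocks.
Variable R : realType.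

Definition block (i i' : nat) (z : R[i]) : R[i] :=
  \sum_(a < 2 ^ i) \sum_(b < 2 ^ i')
    z ^+ ((2 ^ i + a) * (2 ^ i' + b)) / ((2 ^ i + a) * (2 ^ i' + b))%:R.

Lemma normc_block_le1 (i i' : nat) (z : R[i]) : normc z = 1 -> normc (block i i' z) <= 1.
Proof.
move=> z1; rewrite /block pair_big /=.
apply: le_trans (le_normc_sum _ _ _ _ _) _.
apply: le_trans (_ : \sum_(p : 'I_(2 ^ i) * 'I_(2 ^ i')) (2 ^ i * 2 ^ i')%:R^-1 <= _).
  apply: ler_sum => -[a b] _ /=.
  rewrite normcM normcX z1 expr1n mul1r normcV normc_nat.
  by apply: ler_nat_inv; rewrite ?muln_gt0 ?expn_gt0 // leq_mul ?leq_addr.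
rewrite sumr_const card_prod !card_ord -[_ *+ _]mulr_natl divff //.
Qed.

(** With side lengths A and B, coefficients at most 1/(AB) and at most AB min(A, B) coincidences
    bound the mean square by 1/max(A, B). The size of [q] keeps every frequency below [q]. *)
Lemma mean_square_block (q : nat) (zeta : R[i]) (i i' : nat) :
  q.-primitive_root zeta -> (2 ^ i.+1 * 2 ^ i'.+1 <= q)%N ->
  \sum_(j < q) normc (block i i' (zeta ^+ j)) ^+ 2
    <= q%:R * ((3 / 4) ^+ i * (3 / 4) ^+ i').
Proof.
move=> zq qbig.
pose nu (p : 'I_(2 ^ i) * 'I_(2 ^ i')) := ((2 ^ i + p.1) * (2 ^ i' + p.2))%N.
pose A : nat := (2 ^ i)%N; pose B : nat := (2 ^ i')%N.
have A0 : (0 < A)%N by rewrite expn_gt0.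
have B0 : (0 < B)%N by rewrite expn_gt0.
have nuq p : (nu p < q)%N.
  apply: leq_trans qbig; rewrite !expnS !mul2n -!addnn.
  by apply: ltn_mul; rewrite ltn_add2l.
have c_le p : 0 <= ((nu p)%:R^-1 : R) <= (A * B)%:R^-1.
  rewrite invr_ge0 ler0n andTb; apply: ler_nat_inv; first by rewrite muln_gt0 A0.
  by rewrite leq_mul ?leq_addr.
have := mean_square_le R q zeta zq _ nu (fun p => (nu p)%:R^-1) _ nuq c_le.
rewrite (eq_bigr (fun j : 'I_q => normc (block i i' (zeta ^+ j)) ^+ 2)); last first.
  move=> j _; rewrite /block pair_big /=; congr (normc _ ^+ 2).
  by apply: eq_bigr => p _; rewrite fmorphV rmorph_nat mulrC.
move/le_trans; apply; rewrite ler_wpM2l ?ler0n //.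
have cnt : (#|[pred x : _ * _ | nu x.1 == nu x.2]| <= A * B * minn A B)%N.
  exact: card_equal_products.
apply: le_trans (_ : (A * B)%:R^-1 ^+ 2 * (A * B * minn A B)%:R <= _).
  by apply: ler_wpM2l; rewrite ?ler_nat // exprn_ge0 // invr_ge0 ler0n.
have [ii'|i'i] := leqP i i'.
  have -> : minn A B = A by apply/minn_idPl; rewrite leq_exp2l.
  by rewrite sqr_inv_prod_mul // mulrC half_power_le.
have -> : minn A B = B by apply/minn_idPr; rewrite leq_exp2l // ltnW.
by rewrite [(A * B)%N]mulnC sqr_inv_prod_mul // half_power_le // ltnW.
Qed.

End Blocks.

(** * Moments of the harmonic polynomial *)

Section HarmonicPolynomial.
Variable R : realType.

(** The positive-frequency half of e_J. At [z] on the unit circle, adding or subtracting its value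
    at [z^-1] gives twice the real part, or [2i] times the imaginary part. *)
Definition harmonic_poly (J : nat) (z : R[i]) : R[i] :=
  \sum_(1 <= m < 2 ^ J) \sum_(1 <= l < 2 ^ J) z ^+ (m * l) / (m * l)%:R.

Lemma sum_block_row (J i : nat) (z : R[i]) :
  \sum_(i' < J) block R i i' z =
  \sum_(a < 2 ^ i) \sum_(1 <= l < 2 ^ J)
    z ^+ ((2 ^ i + a) * l) / ((2 ^ i + a) * l)%:R.
Proof.
rewrite exchange_big /=; apply: eq_bigr => a _.
exact: (dyadic_sum _ (fun l => z ^+ ((2 ^ i + a) * l) / ((2 ^ i + a) * l)%:R)).
Qed.

Lemma harmonic_poly_blocks (J : nat) (z : R[i]) :
  harmonic_poly J z = \sum_(i < J) \sum_(i' < J) block R i i' z.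
Proof.
under eq_bigr do rewrite sum_block_row.
exact/esym/(dyadic_sum _ (fun m => \sum_(1 <= l < 2 ^ J) z ^+ (m * l) / (m * l)%:R)).
Qed.

(** For fixed m the sum over l is a truncated sawtooth at [z ^+ m], scaled by 1/m; there are [2 ^ i]
    such m, each at least [2 ^ i]. *)
Lemma Im_block_row_le (J i : nat) (z : R[i]) : normc z = 1 ->
  `|complex.Im (\sum_(i' < J) block R i i' z)| <= 3.
Proof.
move=> z1; rewrite sum_block_row Im_sum.
apply: le_trans (ler_norm_sum _ _ _) _.
apply: le_trans (_ : \sum_(a < 2 ^ i) 3 * (2 ^ i)%:R^-1 <= _); last first.
  by rewrite sumr_const card_ord -[_ *+ _]mulr_natr mulfVK.
apply: ler_sum => a _; set m := (2 ^ i + a)%N.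
have m0 : (0 < m)%N by rewrite addn_gt0 expn_gt0.
have -> : \sum_(1 <= l < 2 ^ J) z ^+ (m * l) / (m * l)%:R =
    (m%:R^-1)%:C%C * \sum_(1 <= l < 2 ^ J) (z ^+ m) ^+ l / l%:R :> R[i].
  rewrite mulr_sumr; apply: eq_bigr => l _.
  by rewrite fmorphV rmorph_nat exprM natrM invfM; ring.
have ImZ (x : R) (w : R[i]) : complex.Im (x%:C%C * w) = x * complex.Im w.
  by case: w => a' b' /=; rewrite mul0r addr0.
rewrite ImZ normrM [`|m%:R^-1|]ger0_norm ?invr_ge0 ?ler0n // mulrC.
apply: ler_pM; rewrite ?invr_ge0 ?ler0n ?normr_ge0 //.
  by apply: sine_sum_le; rewrite normcX z1 expr1n.
by apply: ler_nat_inv; rewrite ?expn_gt0 ?leq_addr.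
Qed.

Section Moments.
Variables (q J : nat) (zeta : R[i]).
Hypotheses (zetaq : q.-primitive_root zeta) (qbig : (2 ^ J * 2 ^ J <= q)%N).

Let block_q (i i' : 'I_J) : (2 ^ i.+1 * 2 ^ i'.+1 <= q)%N.
Proof. by apply: leq_trans qbig; rewrite leq_mul // leq_exp2l. Qed.

Let unit_zeta (j : nat) : normc (zeta ^+ j) = 1 := normc_prim_rootX _ _ _ zetaq j.

(** Real parts have no bounded sawtooth sums, so both indices are cut and product weights are used.
    Each index costs a factor [(4 * k.+2%:R) ^+ k.+2]; the sup bound is 2. *)
Lemma moment_Re_harmonic_poly (k : nat) :
  \sum_(j < q) `|2 * complex.Re (harmonic_poly J (zeta ^+ j))| ^+ k.+2 <=
  q%:R * (((4 * k.+2%:R) ^+ k.+2) ^+ 2 * 2 ^+ k.+2).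
Proof.
pose f (p : 'I_J * 'I_J) (j : 'I_q) := 2 * complex.Re (block R p.1 p.2 (zeta ^+ j)).
pose lam (p : 'I_J * 'I_J) := geom_weight R k.+1 p.1 * geom_weight R k.+1 p.2.
pose rho (p : 'I_J * 'I_J) : R := (3 / 4) ^+ p.1 * (3 / 4) ^+ p.2.
have -> : \sum_(j < q) `|2 * complex.Re (harmonic_poly J (zeta ^+ j))| ^+ k.+2
    = \sum_(j < q) `|\sum_p f p j| ^+ k.+2.
  apply: eq_bigr => j _; rewrite harmonic_poly_blocks pair_big /=.
  by rewrite Re_sum mulr_sumr.
apply: (moment_bound _ _ _ _ lam rho) => //.
- by move=> p; rewrite mulr_gt0 ?geom_weight_gt0.
- rewrite -(pair_big xpredT xpredT (fun i i' : 'I_J =>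
    geom_weight R k.+1 i * geom_weight R k.+1 i')) /=.
  under eq_bigr do rewrite -mulr_sumr.
  rewrite -mulr_suml mulr_ile1 ?sum_geom_weight //;
    by apply: sumr_ge0 => i _; rewrite ltW ?geom_weight_gt0.
- move=> p j; rewrite normrM ger0_norm // ler_piMr //.
  by apply: le_trans (normc_geRe _ _) _; rewrite normc_block_le1.
- move=> p; under eq_bigr do rewrite exprMn.
  rewrite -mulr_sumr mulrCA ler_wpM2l ?exprn_ge0 //.
  apply: le_trans (mean_square_block _ _ _ p.1 p.2 zetaq (block_q _ _)).
  by apply: ler_sum => j _; rewrite sqr_normcE lerDl sqr_ge0.
- move=> p; rewrite /rho /lam; set X := (4 * _) ^+ k.+2.
  set u := geom_weight _ _ p.1; set v := geom_weight _ _ p.2.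
  have -> : X ^+ 2 * (u * v) ^+ k.+2 = (X * u ^+ k.+2) * (X * v ^+ k.+2).
    by rewrite [(u * v) ^+ _]exprMn; ring.
  by apply: ler_pM; rewrite ?le_geom_weight // exprn_ge0 // divr_ge0.
Qed.

(** Summing over i' keeps the decay in [i]: this is [moment_bound] with exponent 2 and sup bound 1,
    where 64 = (4 * 2)^2 comes from the weights in i'. *)
Lemma mean_square_Im_row (i : 'I_J) :
  \sum_(j < q) (complex.Im (\sum_(i' < J) block R i i' (zeta ^+ j))) ^+ 2
    <= q%:R * (64 * (3 / 4) ^+ i).
Proof.
pose f (i' : 'I_J) (j : 'I_q) := complex.Im (block R i i' (zeta ^+ j)).
pose rho (i' : 'I_J) : R := (3 / 4) ^+ i * (3 / 4) ^+ i'.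
have r0 n : 0 <= (3 / 4) ^+ n :> R by rewrite exprn_ge0 // divr_ge0.
have -> : \sum_(j < q) (complex.Im (\sum_(i' < J) block R i i' (zeta ^+ j))) ^+ 2
    = \sum_(j < q) `|\sum_i' f i' j| ^+ 2.
  by apply: eq_bigr => j _; rewrite Im_sum real_normK ?num_real.
rewrite -[64 * _]mulr1 -[X in _ * (_ * X)](expr1n _ 2).
apply: (moment_bound _ _ _ f (fun i' => geom_weight R 1 i') rho _ _ _ 0) => //.
- by move=> i'; rewrite geom_weight_gt0.
- by rewrite sum_geom_weight.
- move=> i' j; apply: le_trans (normc_geIm _ _) _.
  by rewrite normc_block_le1.
- move=> i'; rewrite expr1n mul1r.
  apply: le_trans (mean_square_block _ _ _ i i' zetaq (block_q _ _)).
  by apply: ler_sum => j _; rewrite sqr_normcE lerDr sqr_ge0.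
- move=> i'; rewrite /rho [64 * _]mulrC -mulrA ler_wpM2l //.
  apply: le_trans (le_geom_weight R 1 i') _.
  by rewrite (_ : (4 * 2%:R) ^+ 2 = 64 :> R) //; ring.
Qed.

Lemma moment_Im_harmonic_poly (k : nat) :
  \sum_(j < q) `|2 * complex.Im (harmonic_poly J (zeta ^+ j))| ^+ k.+2 <=
  q%:R * ((4 * k.+2%:R) ^+ k.+2 * 16 ^+ k.+2).
Proof.
pose f (i : 'I_J) (j : 'I_q) :=
  2 * complex.Im (\sum_(i' < J) block R i i' (zeta ^+ j)).
pose rho (i : 'I_J) : R := (3 / 4) ^+ i.
have -> : \sum_(j < q) `|2 * complex.Im (harmonic_poly J (zeta ^+ j))| ^+ k.+2
    = \sum_(j < q) `|\sum_i f i j| ^+ k.+2.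
  by apply: eq_bigr => j _; rewrite harmonic_poly_blocks Im_sum mulr_sumr.
(* The constant 16 serves twice: it exceeds the sup bound 2 * 3, and its square is the mean-square
   constant 4 * 64. *)
apply: (moment_bound _ _ _ f (fun i => geom_weight R k.+1 i) rho) => //.
- by move=> i; rewrite geom_weight_gt0.
- by rewrite sum_geom_weight.
- move=> i j; rewrite normrM ger0_norm //.
  by have := Im_block_row_le J i _ (unit_zeta j); lra.
- move=> i; under eq_bigr do rewrite exprMn.
  rewrite -mulr_sumr; apply: le_trans (ler_wpM2l _ (mean_square_Im_row i)) _ => //.
  by rewrite le_eqVlt; apply/orP; left; apply/eqP; rewrite /rho; ring.
- by move=> i; apply: le_geom_weight.
Qed.

End Moments.
End HarmonicPolynomial.

(** * Fourier coefficients and constant terms *)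

Definition prod_count (J n : nat) : nat :=
  (\sum_(1 <= m < 2 ^ J) \sum_(1 <= l < 2 ^ J) (m * l == n))%N.

Lemma sum_by_product (A : nzRingType) (phi : nat -> A) (J : nat) :
  \sum_(1 <= m < 2 ^ J) \sum_(1 <= l < 2 ^ J) phi (m * l)%N =
  \sum_(1 <= n < (2 ^ J * 2 ^ J).+1) (prod_count J n)%:R * phi n.
Proof.
under [RHS]eq_bigr do rewrite natr_sum mulr_suml.
rewrite [RHS]exchange_big /= !big_nat; apply: eq_bigr => m /andP[m0 mJ].
under [RHS]eq_bigr do rewrite natr_sum mulr_suml.
rewrite [RHS]exchange_big /= !big_nat; apply: eq_bigr => l /andP[l0 lJ].
rewrite (eq_bigr (fun n => if n == (m * l)%N then phi n else 0)); last first.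
  by move=> n _; rewrite eq_sym; case: eqP; rewrite ?mul1r ?mul0r.
rewrite -big_mkcond big_nat1_eq muln_gt0 m0 l0 ltnS leq_mul //; exact: ltnW.
Qed.

Lemma count_cofactor (L m n : nat) : (0 < m)%N -> (0 < n)%N ->
  (\sum_(1 <= l < L) (m * l == n) = (m %| n) && (n %/ m < L))%N.
Proof.
move=> m0 n0; have [mn|mn] := boolP (m %| n)%N; last first.
  by rewrite big1 //= => l _; case: eqP mn => // <-; rewrite dvdn_mulr.
rewrite (eq_bigr (fun l => if l == (n %/ m)%N then 1 else 0)%N); last first.
  by move=> l _; rewrite eqn_div // mulnC; case: eqP.
by rewrite -big_mkcond big_nat1_eq divn_gt0 // dvdn_leq //=.
Qed.

Lemma sum_dvdn (L n : nat) :
  (\sum_(1 <= m < L) (m %| n) = size [seq m <- index_iota 1 L | m %| n])%N.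
Proof.
by rewrite size_filter -sum1_count [RHS]big_mkcond; apply: eq_bigr => m _; case: ifP.
Qed.

Lemma prod_count_le (J n : nat) : (0 < n)%N -> (prod_count J n <= num_divisors n)%N.
Proof.
move=> n0; apply: (@leq_trans (\sum_(1 <= m < 2 ^ J) (m %| n))%N).
  rewrite /prod_count !big_nat; apply: leq_sum => m /andP[m0 _].
  by rewrite count_cofactor //; case: (m %| n)%N; rewrite ?leq_b1.
rewrite sum_dvdn; apply: uniq_leq_size; first by rewrite filter_uniq ?iota_uniq.
by move=> m; rewrite mem_filter -dvdn_divisors // => /andP[].
Qed.

Lemma prod_count_eq (J n : nat) : (0 < n < 2 ^ J)%N -> prod_count J n = num_divisors n.
Proof.
move=> /andP[n0 nJ]; transitivity (\sum_(1 <= m < 2 ^ J) (m %| n))%N.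
  rewrite /prod_count !big_nat; apply: eq_bigr => m /andP[m0 _].
  by rewrite count_cofactor // (leq_ltn_trans (leq_div _ _) nJ) andbT.
rewrite sum_dvdn; apply/perm_size/uniq_perm.
- by rewrite filter_uniq ?iota_uniq.
- exact: divisors_uniq.
move=> m; rewrite mem_filter mem_index_iota -dvdn_divisors //.
case: (boolP (m %| n)%N) => //= mn.
by rewrite (dvdn_gt0 n0 mn) (leq_ltn_trans (dvdn_leq n0 mn) nJ).
Qed.

Lemma sum_symmetric_range (V : nmodType) (psi : int -> V) (W : nat) :
  \sum_(a < (2 * W).+1) psi (a%:Z - W%:Z) =
  psi 0 + \sum_(1 <= n < W.+1) (psi n%:Z + psi (- n%:Z)).
Proof.
elim: W => [|W IH]; first by rewrite big_ord1 [in RHS]big_geq //= !addr0.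
rewrite mulnS !addSn add0n big_ord_recl big_ord_recr /=.
rewrite (eq_bigr (fun a : 'I_(2 * W).+1 => psi (a%:Z - W%:Z))); last first.
  by move=> a _; congr psi; rewrite /bump /=; lia.
rewrite IH [in RHS]big_nat_recr //= sub0r.
have -> : (2 * W).+2%:Z - W.+1%:Z = W.+1%:Z by lia.
by rewrite addrC -!addrA.
Qed.

Section Expansion.
Variable R : realType.
Implicit Types (eps : R) (z : R[i]).

(** Coefficient of [z ^ n] in [harmonic_poly] at [z] plus [eps] times its value at [z^-1]. It
    vanishes at [n = 0], because division by zero yields 0. *)
Definition laurent_coef eps (J : nat) (n : int) : R :=
  (if 0 < n then 1 else eps) * ((prod_count J `|n|)%:R / `|n|%N%:R).

Definition range_bound (J : nat) : nat := (2 ^ J * 2 ^ J)%N.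

(** Encodes the integers of [-W, W] by ordinals, so that powers expand over a finite function
    type. *)
Definition centered (W : nat) (a : 'I_(2 * W).+1) : int := a%:Z - W%:Z.

Lemma harmonic_poly_laurent eps (J : nat) z : z != 0 ->
  harmonic_poly R J z + eps%:C%C * harmonic_poly R J z^-1 =
  \sum_(a < (2 * range_bound J).+1)
    (laurent_coef eps J (centered (range_bound J) a))%:C%C *
    z ^ centered (range_bound J) a.
Proof.
move=> z0; set W := range_bound J.
rewrite (sum_symmetric_range _ (fun n => (laurent_coef eps J n)%:C%C * z ^ n)).
rewrite /laurent_coef /= invr0 !mulr0 mul0r add0r big_split /=.
rewrite /harmonic_poly !(sum_by_product _ (fun n => _ ^+ n / n%:R)) mulr_sumr.
congr (_ + _); rewrite !big_nat; apply: eq_bigr => n /andP[n0 _].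
  rewrite ltz_nat n0 mul1r rmorphM /= fmorphV !rmorph_nat -exprnP.
  by rewrite -mulrA [n%:R^-1 * _]mulrC.
rewrite oppr_gt0 ltz_nat ltn0 abszN !rmorphM /= fmorphV !rmorph_nat.
by rewrite -exprnN exprVn; ring.
Qed.

Definition constant_term eps (J k : nat) : R :=
  \sum_(f : {ffun 'I_k -> 'I_(2 * range_bound J).+1} |
         \sum_i centered (range_bound J) (f i) == 0)
     \prod_i laurent_coef eps J (centered (range_bound J) (f i)).

Lemma absz_centered (W : nat) (a : 'I_(2 * W).+1) : (`|centered W a| <= W)%N.
Proof. by rewrite /centered; have := ltn_ord a; lia. Qed.

Lemma absz_sum_le (k W : nat) (g : 'I_k -> int) :
  (forall i, (absz (g i) <= W)%N) -> (absz (\sum_i g i)%R <= k * W)%N.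
Proof.
move=> gW; rewrite -lez_nat abszE; apply: le_trans (ler_norm_sum _ _ _) _.
apply: le_trans (_ : \sum_(i < k) W%:Z <= _).
  by apply: ler_sum => i _; rewrite -abszE lez_nat.
by rewrite sumr_const card_ord -mulr_natl PoszM natz.
Qed.

(** Every exponent in the expanded power has modulus at most [k * range_bound J], hence below [q],
    so averaging keeps exactly the zero-sum terms. *)
Lemma sum_power_laurent eps (J k q : nat) (zeta : R[i]) :
  q.-primitive_root zeta -> (k * range_bound J < q)%N ->
  \sum_(j < q) (harmonic_poly R J (zeta ^+ j) +
      eps%:C%C * harmonic_poly R J (zeta ^+ j)^-1) ^+ k =
  (q%:R * constant_term eps J k)%:C%C.
Proof.
move=> zq kq; set W := range_bound J.
have z0 : zeta != 0 := prim_root_neq0 _ _ _ zq.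
rewrite (eq_bigr (fun j : 'I_q => \sum_(f : {ffun 'I_k -> 'I_(2 * W).+1})
  (\prod_i laurent_coef eps J (centered W (f i)))%:C%C *
  (zeta ^+ j) ^ (\sum_i centered W (f i)))); last first.
  move=> j _; have zj : zeta ^+ j != 0 by rewrite expf_neq0.
  rewrite harmonic_poly_laurent // -/W -[in LHS](card_ord k) -prodr_const.
  rewrite bigA_distr_bigA /=; apply: eq_bigr => f _.
  rewrite big_split /= rmorph_prod; congr (_ * _).
  by rewrite (big_morph _ (fun m n => expfzDr m n zj) (expr0z _)).
rewrite exchange_big rmorphM rmorph_nat /= /constant_term rmorph_sum /= mulr_sumr.
rewrite [RHS]big_mkcond /=; apply: eq_bigr => f _.
rewrite -mulr_sumr (sum_unity_root _ _ _ _ zq) dvdz_small; last first.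
  by apply: leq_ltn_trans kq; apply: absz_sum_le => i; apply: absz_centered.
by case: eqP => _; rewrite ?mulr0 // mulrC.
Qed.

Lemma harmonic_poly_conj (J : nat) z :
  harmonic_poly R J (z^*)%C = ((harmonic_poly R J z)^*)%C.
Proof.
rewrite /harmonic_poly !rmorph_sum /=; apply: eq_bigr => m _.
rewrite !rmorph_sum /=; apply: eq_bigr => l _.
by rewrite [RHS]rmorphM fmorphV rmorphXn rmorph_nat.
Qed.

Lemma exists_large_prim_root (n : nat) :
  {q : nat & {zeta : R[i] | (n < q)%N & q.-primitive_root zeta}}.
Proof.
have [zeta zq] : {z : R[i] | n.+1.-primitive_root z}.
  by apply: exists_prim_root; rewrite pnatr_eq0.
by exists n.+1, zeta.
Qed.

(** Moments are available only from exponent 2 on; bounding t^k by 1 + |t|^(k+2) covers every [k] at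
    once. *)
Lemma constant_term1_le (J k : nat) :
  constant_term 1 J k <= 1 + ((4 * k.+2%:R) ^+ k.+2) ^+ 2 * 2 ^+ k.+2.
Proof.
(* The factor [k.+1] makes [q] exceed [range_bound J] even when [k] is 0. *)
have [q [zeta qbig zq]] := exists_large_prim_root (k.+1 * range_bound J)%N.
have q0 : (0 < q)%N := prim_order_gt0 zq.
have qW : (2 ^ J * 2 ^ J <= q)%N.
  by apply: leq_trans (ltnW qbig); rewrite leq_pmull.
have qk : (k * range_bound J < q)%N.
  by apply: leq_ltn_trans qbig; rewrite leq_mul.
have := sum_power_laurent 1 J k q zeta zq qk.
pose g (j : 'I_q) := 2 * complex.Re (harmonic_poly R J (zeta ^+ j)).
rewrite (eq_bigr (fun j => (g j ^+ k)%:C%C)); last first.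
  move=> j _; rewrite -conjc_unit ?(normc_prim_rootX _ _ _ zq) //.
  by rewrite harmonic_poly_conj mul1r addcJ rmorphXn rmorphM /= rmorph_nat.
rewrite -rmorph_sum => /complexI e.
rewrite -(@ler_pM2l _ q%:R) ?ltr0n // -e.
have := moment_Re_harmonic_poly R q J zeta zq qW k; set M := _ * 2 ^+ k.+2.
rewrite mulrDr mulr1 => le_M; apply: le_trans (lerD (lexx _) le_M).
rewrite -[X in X%:R + _](card_ord q) -sumr_const -big_split /=.
apply: ler_sum => j _; rewrite -/(g j); apply: le_trans (ler_norm _) _.
rewrite normrX; have [g1|g1] := leP `|g j| 1.
  by rewrite ler_wpDr ?exprn_ge0 // exprn_ile1.
by rewrite ler_wpDl // ler_weXn2l ?ltW // -addn2 leq_addr.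
Qed.

(** The minus sign leaves [2i] times the imaginary part; the power of [i] factors out of the average
    with modulus 1. *)
Lemma constant_termN1_le (J k : nat) :
  `|constant_term (-1) J k.+2| <= (4 * k.+2%:R) ^+ k.+2 * 16 ^+ k.+2.
Proof.
have [q [zeta qbig zq]] := exists_large_prim_root (k.+2 * range_bound J)%N.
have q0 : (0 < q)%N := prim_order_gt0 zq.
have qW : (2 ^ J * 2 ^ J <= q)%N.
  by apply: leq_trans (ltnW qbig); rewrite leq_pmull.
have := sum_power_laurent (-1) J k.+2 q zeta zq qbig.
pose g (j : 'I_q) := 2 * complex.Im (harmonic_poly R J (zeta ^+ j)).
rewrite (eq_bigr (fun j => (g j ^+ k.+2)%:C%C * 'i%C ^+ k.+2)); last first.
  move=> j _; rewrite -conjc_unit ?(normc_prim_rootX _ _ _ zq) //.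
  rewrite harmonic_poly_conj rmorphN1 mulN1r subcJ exprMn.
  by rewrite rmorphXn rmorphM /= rmorph_nat.
rewrite -mulr_suml -rmorph_sum => e.
rewrite -(@ler_pM2l _ q%:R) ?ltr0n //.
apply: le_trans (moment_Im_harmonic_poly R q J zeta zq qW k).
have -> : q%:R * `|constant_term (-1) J k.+2| = `|\sum_(j < q) g j ^+ k.+2|.
  rewrite -[q%:R]ger0_norm ?ler0n // -normrM -!normc_real -e normcM normcX.
  rewrite (_ : normc 'i%C = 1) ?expr1n ?mulr1 //.
  by rewrite /normc /= expr0n add0r expr1n sqrtr1.
apply: le_trans (ler_norm_sum _ _ _) _.
by apply: ler_sum => j _; rewrite normrX.
Qed.

End Expansion.

(** * Finite approximation of absolutely summable families *)

Section AbsSum.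
Variables (R : realType) (T : choiceType) (D : set T).
Implicit Types (g f u : T -> R) (s t : seq T).

Lemma sum_le_esum g t : (forall x, 0 <= g x) -> uniq t -> (forall x, x \in t -> D x) ->
  ((\sum_(x <- t) g x)%:E <= \esum_(x in D) (g x)%:E)%E.
Proof.
move=> g0 ut tD; apply: esum_ge; exists [set` t].
  by split; [exact: finite_seq | move=> x /= /tD].
by rewrite -fsbig_seq // -sumEFin.
Qed.

Lemma esum_adherent g e : (forall x, 0 <= g x) ->
  (\esum_(x in D) (g x)%:E < +oo)%E -> 0 < e ->
  exists s, [/\ uniq s, (forall x, x \in s -> D x) &
    fine (\esum_(x in D) (g x)%:E) - e < \sum_(x <- s) g x].
Proof.
move=> g0 gfin e0.
have gnum : (\esum_(x in D) (g x)%:E)%E \is a fin_num.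
  by rewrite ge0_fin_numE // esum_ge0 // => x _; rewrite lee_fin.
have [_ [X [finX XD] <-]] := ub_ereal_sup_adherent e0 gnum.
rewrite fsbig_finite // sumEFin -/(esum D _) -(fineK gnum) -EFinB lte_fin => lt_X.
exists (finmap.enum_fset (fset_set X)); split=> //.
by move=> x; rewrite in_fset_set // inE => /XD.
Qed.

(* A finite sum computes [abs_sum] up to [3 e] as soon as it contains a suitable
   finite set, even if [f] is replaced outside that set by some [u] it dominates. *)
Lemma abs_sum_approx f e : summable D (EFin \o f) -> 0 < e ->
  exists s, [/\ uniq s, (forall x, x \in s -> D x) &
    forall t u, uniq t -> {subset s <= t} -> (forall x, x \in t -> D x) ->
      (forall x, x \in t -> `|u x| <= `|f x|) ->
      (forall x, x \in s -> u x = f x) ->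
      `|abs_sum D f - \sum_(x <- t) u x| <= 3 * e].
Proof.
move=> sf e0.
(* [s] carries all but [e] of the total mass of |f|. *)
have [s [us sD s_lt]] := esum_adherent (fun x => `|f x|) e (fun x => normr_ge0 (f x)) sf e0.
exists s; split=> // t u ut st tD uf usf.
pose p := f^\+; pose n := f^\-.
have p0 x : 0 <= p x := funrpos_ge0 f x.
have n0 x : 0 <= n x := funrneg_ge0 f x.
have pn x : `|f x| = p x + n x by rewrite -[RHS]/((f^\+ + f^\-) x) funrposDneg.
have fpn x : f x = p x - n x by rewrite -[RHS]/((f^\+ - f^\-) x) funrposBneg.
have posE : (\esum_(x in D) ((EFin \o f)^\+ x) = \esum_(x in D) (p x)%:E)%E.
  by rewrite funerpos.
have negE : (\esum_(x in D) ((EFin \o f)^\- x) = \esum_(x in D) (n x)%:E)%E.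
  by rewrite funerneg.
set A := fine (\esum_(x in D) (`|f x|)%:E)%E in s_lt.
pose P := fine (\esum_(x in D) (p x)%:E)%E.
pose N := fine (\esum_(x in D) (n x)%:E)%E.
have lt_oo g : (forall x, 0 <= g x) -> (forall x, g x <= `|f x|) ->
    (\esum_(x in D) (g x)%:E)%E \is a fin_num.
  move=> g0 gf; rewrite ge0_fin_numE; last first.
    by rewrite esum_ge0 // => x _; rewrite lee_fin.
  by apply: le_lt_trans sf; apply: le_esum => x _; rewrite lee_fin.
have ple x : p x <= `|f x| by rewrite pn lerDl.
have nle x : n x <= `|f x| by rewrite pn lerDr.
have pfin := lt_oo p p0 ple.
have nfin := lt_oo n n0 nle.
have afin := lt_oo _ (fun x => normr_ge0 (f x)) (fun x => lexx _).
have PNA : P + N = A.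
  rewrite /P /N -fineD // -esumD => [|x _|x _]; rewrite ?lee_fin //.
  by congr fine; apply: eq_esum => x _; rewrite pn EFinD.
have Pt : \sum_(x <- t) p x <= P by rewrite -lee_fin fineK // sum_le_esum.
have Nt : \sum_(x <- t) n x <= N by rewrite -lee_fin fineK // sum_le_esum.
have At : \sum_(x <- t) `|f x| <= A by rewrite -lee_fin fineK // sum_le_esum.
have st_abs : \sum_(x <- t | x \in s) `|f x| = \sum_(x <- s) `|f x|.
  rewrite -big_filter; apply: perm_big; apply: uniq_perm => //.
    exact: filter_uniq.
  move=> x; rewrite mem_filter; case: (boolP (x \in s)) => //= xs.
  exact: st.
have sum_abs : \sum_(x <- t) `|f x| = \sum_(x <- t) p x + \sum_(x <- t) n x.
  by rewrite -big_split /=; apply: eq_bigr => x _.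
have sum_f : \sum_(x <- t) f x = \sum_(x <- t) p x - \sum_(x <- t) n x.
  by rewrite -sumrB; apply: eq_bigr => x _.
have outside : \sum_(x <- t | x \notin s) `|f x| <= e.
  move: At; rewrite (bigID (fun x => x \in s)) /= st_abs; lra.
have fu : `|\sum_(x <- t) f x - \sum_(x <- t) u x| <= 2 * e.
  rewrite -sumrB; apply: le_trans (ler_norm_sum _ _ _) _.
  rewrite (bigID (fun x => x \in s)) /= big1 ?add0r; last first.
    by move=> x xs; rewrite usf // subrr normr0.
  apply: le_trans (_ : 2 * \sum_(x <- t | x \notin s) `|f x| <= _).
    rewrite mulr_sumr big_seq_cond [leRHS]big_seq_cond.
    apply: ler_sum => x /andP[xt _]; apply: le_trans (ler_normB _ _) _.
    by have := uf x xt; lra.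
  lra.
rewrite /abs_sum posE negE -/P -/N.
(* The two missing masses are nonnegative and add up to at most [e], so their difference costs [e];
   replacing [f] by [u] costs [2 * e]. *)
rewrite (_ : _ - _ = (P - \sum_(x <- t) p x) - (N - \sum_(x <- t) n x) +
   (\sum_(x <- t) f x - \sum_(x <- t) u x)); last by rewrite sum_f; ring.
apply: le_trans (ler_normD _ _) _.
suff : `|(P - \sum_(x <- t) p x) - (N - \sum_(x <- t) n x)| <= e by lra.
have st_le : \sum_(x <- s) `|f x| <= \sum_(x <- t) `|f x|.
  by rewrite -st_abs [leRHS](bigID (fun x => x \in s)) /= lerDl sumr_ge0.
by rewrite ler_norml; apply/andP; split; lra.
Qed.

End AbsSum.

(** * Zero-sum tuples *)

Section Tuples.
Variables (R : realType) (k : nat).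
Local Notation tuple_int := {ffun 'I_k -> int}.

Definition centered_tuple (W : nat) (f : {ffun 'I_k -> 'I_(2 * W).+1}) : tuple_int :=
  [ffun i => centered W (f i)].

Lemma centered_tuple_inj (W : nat) : injective (centered_tuple W).
Proof.
move=> f g /ffunP fg; apply/ffunP => i; apply: val_inj => /=.
by have := fg i; rewrite !ffunE /centered; lia.
Qed.

Definition box (W : nat) : seq tuple_int :=
  [seq centered_tuple W f | f <- enum [pred f : {ffun 'I_k -> 'I_(2 * W).+1} |
     [forall i, centered W (f i) != 0] && (\sum_i centered W (f i) == 0)]].

Lemma uniq_box (W : nat) : uniq (box W).
Proof. by rewrite map_inj_uniq ?enum_uniq //; apply: centered_tuple_inj. Qed.

Lemma box_sub (W : nat) (n : tuple_int) : n \in box W -> zero_sum_tuples k n.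
Proof.
move=> /mapP[f]; rewrite mem_enum inE => /andP[/forallP f0 /eqP fs] ->.
split; first by move=> i; rewrite ffunE.
by rewrite -[RHS]fs; apply: eq_bigr => i _; rewrite ffunE.
Qed.

Lemma mem_box (W : nat) (n : tuple_int) :
  zero_sum_tuples k n -> (forall i, (absz (n i) <= W)%N) -> n \in box W.
Proof.
move=> [n0 ns] nW; pose f : {ffun 'I_k -> 'I_(2 * W).+1} :=
  [ffun i => inord (absz (n i + W%:Z))].
have fE i : centered W (f i) = n i.
  have h := nW i; rewrite /centered ffunE inordK; lia.
apply/mapP; exists f; last by apply/ffunP => i; rewrite ffunE fE.
rewrite mem_enum inE; apply/andP; split.
  by apply/forallP => i; rewrite fE.
by apply/eqP; rewrite -[RHS]ns; apply: eq_bigr => i _; rewrite fE.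
Qed.

Definition laurent_prod (eps : R) (J : nat) (n : tuple_int) : R :=
  \prod_i laurent_coef R eps J (n i).

(** Tuples with a zero entry, absent from the box, contribute nothing since the coefficient at 0 is
    0. *)
Lemma constant_term_box (eps : R) (J : nat) :
  constant_term R eps J k = \sum_(n <- box (range_bound J)) laurent_prod eps J n.
Proof.
rewrite big_map big_enum_cond /= /constant_term.
rewrite [RHS]big_mkcond [LHS]big_mkcond /=; apply: eq_bigr => f _.
rewrite inE andbT; case: (boolP [forall i, _]) => [_|].
  rewrite andTb; case: ifP => // _.
  by apply: eq_bigr => i _; rewrite ffunE.
move=> /negP nz; have [i fi0] : exists i, centered (range_bound J) (f i) = 0.
  apply: contrapT => none; apply: nz; apply/forallP => i.
  by apply/eqP => fi0; apply: none; exists i.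
rewrite andFb; case: ifP => // _.
by rewrite (bigD1 i) //= fi0 /laurent_coef /= invr0 !mulr0 mul0r.
Qed.

Lemma H_termE (n : tuple_int) :
  H_term R k n = \prod_i ((num_divisors (absz (n i)))%:R / (n i)%:~R).
Proof. by rewrite /H_term prodf_div. Qed.

Lemma intr_absz_sign (n : int) :
  (n%:~R)^-1 = (if 0 < n then 1 else -1) * (absz n)%:R^-1 :> R.
Proof.
case: n => [[|n]|n]; rewrite ?invr0 ?mulr0 ?mul1r //=.
by rewrite NegzE mulrNz invrN mulN1r.
Qed.

Lemma laurent_coefN1E (J : nat) (n : int) : n != 0 -> (absz n < 2 ^ J)%N ->
  laurent_coef R (-1) J n = (num_divisors (absz n))%:R / n%:~R.
Proof.
move=> n0 nJ; rewrite /laurent_coef prod_count_eq ?absz_gt0 ?n0 //.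
by rewrite intr_absz_sign mulrCA.
Qed.

Lemma norm_laurent_coef_le (eps : R) (J : nat) (n : int) : `|eps| = 1 -> n != 0 ->
  `|laurent_coef R eps J n| <= `|(num_divisors (absz n))%:R / n%:~R|.
Proof.
move=> eps1 n0; rewrite /laurent_coef !normrM.
have -> : `|if 0 < n then 1 else eps| = 1 by case: ifP; rewrite ?normr1.
rewrite mul1r !normfV [`|n%:~R|](_ : _ = `|(absz n)%:R|); last first.
  by rewrite -intr_norm -abszE [RHS]ger0_norm.
by apply: ler_wpM2r; rewrite // !ger0_norm // ler_nat prod_count_le ?absz_gt0.
Qed.

Lemma laurent_coef1E (J : nat) (n : int) : n != 0 -> (absz n < 2 ^ J)%N ->
  laurent_coef R 1 J n = `|(num_divisors (absz n))%:R / n%:~R|.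
Proof.
move=> n0 nJ; rewrite /laurent_coef prod_count_eq ?absz_gt0 ?n0 //.
rewrite if_same mul1r normrM ger0_norm // normfV.
by rewrite -intr_norm -abszE.
Qed.

Lemma norm_laurent_prod_le (eps : R) (J : nat) (n : tuple_int) : `|eps| = 1 ->
  zero_sum_tuples k n -> `|laurent_prod eps J n| <= `|H_term R k n|.
Proof.
move=> eps1 [n0 _]; rewrite H_termE /laurent_prod !normr_prod.
by apply: ler_prod => i _; rewrite normr_ge0 norm_laurent_coef_le.
Qed.

Lemma exists_scale (s : seq tuple_int) :
  exists J, forall n, n \in s -> forall i, (absz (n i) < 2 ^ J)%N.
Proof.
(* A crude choice: J bounds every entry and J < 2^J. *)
exists (\sum_(n <- s) \sum_i absz (n i))%N => n ns i.
apply: leq_ltn_trans (ltn_expl _ _) => //.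
by rewrite (big_rem n ns) /= (bigD1 i) //= -!addnA leq_addr.
Qed.

Lemma scale_mem_box (J : nat) (n : tuple_int) : zero_sum_tuples k n ->
  (forall i, (absz (n i) < 2 ^ J)%N) -> n \in box (range_bound J).
Proof.
move=> Dn nJ; apply: mem_box => // i; apply: leq_trans (ltnW (nJ i)) _.
by rewrite leq_pmulr ?expn_gt0.
Qed.

(** For J large, a finite sum of absolute values is part of the constant term with [eps = 1], whose
    terms are nonnegative and whose bound does not depend on J. *)
Lemma summable_H_term : summable (zero_sum_tuples k) (EFin \o H_term R k).
Proof.
pose B : R := 1 + ((4 * k.+2%:R) ^+ k.+2) ^+ 2 * 2 ^+ k.+2.
apply: (@le_lt_trans _ _ B%:E); last exact: ltry.
apply: ge_ereal_sup => _ [X [finX XD] <-].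
rewrite fsbig_finite //= sumEFin lee_fin.
set s := finmap.enum_fset _.
have sD n : n \in s -> zero_sum_tuples k n by rewrite in_fset_set // inE => /XD.
have [J sJ] := exists_scale s.
apply: le_trans (constant_term1_le R J k); rewrite constant_term_box.
have coef_ge0 n : zero_sum_tuples k n -> 0 <= laurent_prod 1 J n.
  move=> [n0 _]; apply: prodr_ge0 => i _; rewrite /laurent_coef if_same mul1r.
  by rewrite divr_ge0.
have sub : {subset s <= box (range_bound J)}.
  by move=> n ns; apply: scale_mem_box; [exact: sD | exact: sJ].
have us : uniq s by exact: finmap.fset_uniq.
apply: le_trans (_ : \sum_(n <- box (range_bound J) | n \in s) laurent_prod 1 J n <= _).
  rewrite -[leRHS]big_filter [leRHS](perm_big s) /=; last first.
    apply: uniq_perm; rewrite ?filter_uniq ?uniq_box // => n.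
    by rewrite mem_filter; case: (boolP (n \in s)) => //= /sub ->.
  rewrite big_seq_cond [leRHS]big_seq_cond; apply: ler_sum => n /andP[ns _].
  rewrite H_termE normr_prod /laurent_prod le_eqVlt; apply/orP; left; apply/eqP.
  have [n0 _] := sD n ns.
  by apply: eq_bigr => i _; rewrite laurent_coef1E ?n0 ?sJ.
rewrite [leRHS](bigID (fun n => n \in s)) /= lerDl big_seq_cond sumr_ge0 // => n.
by move=> /andP[/box_sub Dn _]; apply: coef_ge0.
Qed.

(** For J large the coefficient products equal [H_term] on any prescribed finite set and are
    dominated by it on the rest of the box, so constant terms approximate the full sum. *)
Lemma norm_abs_sum_le (B : R) :
  (forall J, `|constant_term R (-1) J k| <= B) ->
  `|abs_sum (zero_sum_tuples k) (H_term R k)| <= B.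
Proof.
move=> cB; apply/ler_addgt0Pr => e e0.
have e3 : 0 < e / 3 by rewrite divr_gt0.
have [s [us sD approx]] := abs_sum_approx _ _ _ _ _ summable_H_term e3.
have [J sJ] := exists_scale s.
have := approx (box (range_bound J)) (laurent_prod (-1) J) (uniq_box _).
rewrite -constant_term_box => h.
have := cB J; set c := constant_term _ _ _ _ in h *; move=> cle.
rewrite -[abs_sum _ _](subrK c) addrC; apply: le_trans (ler_normD _ _) _.
apply: lerD => //; apply: le_trans (h _ _ _ _) _; last by lra.
- by move=> n ns; apply: scale_mem_box; [exact: sD | exact: sJ].
- by move=> n /box_sub.
- by move=> n /box_sub Dn; apply: norm_laurent_prod_le; rewrite ?normrN1.
- move=> n ns; rewrite H_termE; apply: eq_bigr => i _.
  by have [n0 _] := sD n ns; rewrite laurent_coefN1E ?n0 ?sJ.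
Qed.

(** Negating the tuple permutes the index set and flips the sign of each term, so the positive and
    negative parts have the same sum. *)
Lemma abs_sum_odd : odd k -> abs_sum (zero_sum_tuples k) (H_term R k) = 0.
Proof.
move=> oddk; pose neg (n : tuple_int) : tuple_int := [ffun i => - n i].
have negK : involutive neg by move=> n; apply/ffunP => i; rewrite !ffunE opprK.
have negD n : zero_sum_tuples k n -> zero_sum_tuples k (neg n).
  move=> [n0 ns]; split; first by move=> i; rewrite ffunE oppr_eq0.
  by under eq_bigr do rewrite ffunE; rewrite sumrN ns oppr0.
have negH n : H_term R k (neg n) = - H_term R k n.
  rewrite !H_termE; under eq_bigr do rewrite ffunE abszN mulrNz invrN mulrN.
  by rewrite prodrN card_ord -signr_odd oddk expr1 mulN1r.
have negb : set_bij (zero_sum_tuples k) (zero_sum_tuples k) neg.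
  split; first by move=> n /negD.
    by move=> n m _ _ /(congr1 neg); rewrite !negK.
  by move=> n Dn; exists (neg n); [exact: negD | rewrite negK].
rewrite /abs_sum (reindex_esum (zero_sum_tuples k) _ neg _ negb).
under eq_esum => n _ do rewrite funeposE /= negH.
by under [in X in _ - fine X]eq_esum => n _ do rewrite funenegE /=; rewrite subrr.
Qed.

End Tuples.

(** * Factorial growth and the final bound *)

(** k^k / k! is one term of the exponential series of e^k. *)
Lemma power_self_le_fact (R : realType) (k : nat) :
  k%:R ^+ k <= expR 1 ^+ k * k`!%:R :> R.
Proof.
case: k => [|k]; first by rewrite !expr0 mul1r.
rewrite -expRM_natr mul1r -ler_pdivrMr ?ltr0n ?fact_gt0 //.
by apply: le_trans (expR_ge1Dxn k _) => //; rewrite lerDr.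
Qed.

Lemma constant_term_nil (R : realType) (eps : R) (J : nat) : constant_term R eps J 0 = 1.
Proof.
rewrite /constant_term (eq_bigl xpredT) => [|f]; last by rewrite big_ord0 eqxx.
rewrite (eq_bigr (fun=> 1)) => [|f _]; last by rewrite big_ord0.
by rewrite sumr_const card_ffun !card_ord expn0.
Qed.

(** The prefactor has modulus pi^(-2k), at most 1, and is simply discarded. *)
Lemma normc_H_le (R : realType) (k : nat) :
  normc (H R k) <= `|abs_sum (zero_sum_tuples k) (H_term R k)|.
Proof.
rewrite /H normcM normc_real normcV normcX normcM normc_real.
rewrite (_ : normc _ = 1); last by rewrite /normc /= expr0n add0r expr1n sqrtr1.
rewrite mul1r ler_piMl // ger0_norm ?sqr_ge0 //.
by rewrite invf_le1 ?exprn_ege1 ?exprn_gt0 ?pi_gt0 // (le_trans _ (pi_ge2 R)) // ler1n.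
Qed.

Theorem theorem1p2 (R : realType) :
  (* the family defining H_k is absolutely summable, so H_k is well defined *)
  (forall k : nat, summable (zero_sum_tuples k) (EFin \o H_term R k)) /\
  (forall k : nat, odd k -> H R k = 0) /\
  (exists A C : R, 0 < A /\
     forall k : nat, `|H R k| <= (C * A ^+ k * (k`!)%:R)%:C%C).
Proof.
have H_odd k : odd k -> H R k = 0.
  by move=> /(abs_sum_odd R) H0; rewrite /H H0 rmorph0 mulr0.
split; first exact: summable_H_term.
(* 64 = 4 * 16 comes from the moment bound, and e from comparing k^k with k!. *)
split=> //; exists (64 * expR 1), 1; split; first by rewrite mulr_gt0 ?expR_gt0.
move=> k; rewrite -[`|H R k|]/((normc (H R k))%:C%C) lecR mul1r.
(* The moment bound starts at exponent 2: [k = 1] is settled by oddness and [k = 0] by the empty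
   product. *)
have [->|k1] := eqVneq k 1%N.
  by rewrite H_odd // normc0 !mulr_ge0 ?exprn_ge0 ?mulr_ge0 ?expR_ge0.
apply: le_trans (normc_H_le R k) _; apply: norm_abs_sum_le => J.
case: k k1 => [|[|k]] // _; first by rewrite constant_term_nil normr1 expr0 mul1r.
apply: le_trans (constant_termN1_le R J k) _.
rewrite -exprMn (_ : 4 * k.+2%:R * 16 = 64 * k.+2%:R); last by ring.
rewrite [(64 * k.+2%:R) ^+ _]exprMn [(64 * expR 1) ^+ _]exprMn -[leRHS]mulrA.
apply: ler_wpM2l; first by rewrite exprn_ge0.
exact: power_self_le_fact.
Qed.
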